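(* Let $(G,\tau)$ and $(H,\sigma)$ be topological groups and $f:(G,\tau)\to(H,\sigma)$ a continuous surjective homomorphism such that $\ker f\subseteq N_\tau$. The following are equivalent: (a) $f$ is strongly A-open; (b) $f$ is strongly A$^*$-open; (c) $f$ is A$^*$-open; (d) $f$ is A-open; (e) $f$ is semitopological.
   Context: Topological groups are not assumed Hausdorff. $N_\tau$ denotes the closure $\overline{\{e_G\}}^{\tau}$ of $\{e_G\}$ in $(G,\tau)$. $\mathcal V_{(G,\tau)}(e_G)$ is the filter of all neighborhoods of $e_G$ in $(G,\tau)$. For a neighborhood $U$ of $e_G$, a subset $M\subseteq G$ is $U$-thin if $\bigcap\{x^{-1}Ux:x\in M\}$ is a neighborhood of $e_G$. Write $[x,y]=xyx^{-1}y^{-1}$ and, for $g\in G$ and $K\subseteq G$, $[g,K]=\{[g,k]:k\in K\}$. A section of a surjective homomorphism $f:G\to H$ is an injective function $s:H\to G$ such that $f(s(h))=h$ for every $h\in H$ and $s(e_H)=e_G$ (no continuity required). A map $t:H\to G$ between topological groups is a quasihomomorphism if $t(e_H)=e_G$, the map $t':H\times H\to G$, $t'(h_1,h_2)=t(h_1)t(h_2)t(h_1h_2)^{-1}$, is continuous at $(e_H,e_H)$, and for every $y\in H$ the map $t_y:H\to G$, $t_y(h)=t(y)t(h)t(y)^{-1}t(yhy^{-1})^{-1}$, is continuous at $e_H$. Let $f:(G,\tau)\to(H,\sigma)$ be a surjective homomorphism. - $f$ is A-open if for every $U\in\mathcal V_{(G,\tau)}(e_G)$ there exists $V\in\mathcal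 V_{(H,\sigma)}(e_H)$ such that $f^{-1}(V)$ is $f^{-1}(f(U))$-thin, and for every $g\in G$ there exists $V_g\in\mathcal V_{(H,\sigma)}(e_H)$ such that $[g,f^{-1}(V_g)]\subseteq f^{-1}(f(U))$. - $f$ is A$^*$-open if there exists a section $s$ of $f$ such that for every $U\in\mathcal V_{(G,\tau)}(e_G)$ there exists $V\in\mathcal V_{(H,\sigma)}(e_H)$ such that $s(V)$ is $U$-thin, and for every $g\in G$ there exists $V_g\in\mathcal V_{(H,\sigma)}(e_H)$ such that $[g,s(V_g)]\subseteq U$; if such an $s$ can be chosen to be also a quasihomomorphism, $f$ is strongly A$^*$-open. - $f$ is strongly A-open if for every $U\in\mathcal V_{(G,\tau)}(e_G)$ there exists $V\in\mathcal V_{(H,\sigma)}(e_H)$ such that $f^{-1}(V)$ is $U$-thin, and for every $g\in G$ there exists $V_g\in\mathcal V_{(H,\sigma)}(e_H)$ such that $[g,f^{-1}(V_g)]\subseteq U$. - If $f$ is continuous, $f$ is semitopological if there exist a topological group $(\widetilde G,\widetilde\tau)$ containing $G$ as a topological normal subgroup (i.e. $G$ is, up to identification, a normal subgroup of $\widetilde G$ and $\widetilde\tau\restriction_G=\tau$) and an open continuous homomorphism $\widetilde f:(\widetilde G,\widetilde\tau)\to(H,\sigma)$ extending $f$. *)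

(* Defs.v *)
From HB Require Import structures.
From mathcomp Require Import all_boot.
From mathcomp Require Import all_classical topology.

Set Implicit Arguments.
Unset Strict Implicit.
Unset Printing Implicit Defensive.

Local Open Scope classical_set_scope.
Local Open Scope group_scope.

(* No separation axiom is required. *)
HB.mixin Record isTopologicalGroup G of Topological G & Group G := {
  mulg_continuous : continuous (fun x : G * G => x.1 * x.2) ;
  invg_continuous : continuous (fun x : G => x^-1)
}.

#[short(type="topologicalGroupType")]
HB.structure Definition TopologicalGroup :=
  {G of Topological G & Group G & isTopologicalGroup G}.

(* This is not the library's [~ x, y], which is x^-1 * y^-1 * x * y. *)
Definition lcommg (G : groupType) (x y : G) : G := x * y * x^-1 * y^-1.

(* u ^ x is the library's conjugation x^-1 * u * x. *)
Definition thin (G : topologicalGroupType) (U M : set G) : Prop :=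
  nbhs (1 : G) (\bigcap_(x in M) [set u ^ x | u in U]).

Section Openness.
Variables (G H : topologicalGroupType) (f : G -> H).

Definition is_section (s : H -> G) : Prop :=
  [/\ injective s, forall h, f (s h) = h & s 1 = 1].

Definition quasihomomorphism (t : H -> G) : Prop :=
  [/\ t 1 = 1,
      {for (1, 1), continuous
        (fun h : H * H => t h.1 * t h.2 * (t (h.1 * h.2))^-1)}
    & forall y : H, {for 1, continuous
        (fun h : H => t y * t h * (t y)^-1 * (t (y * h * y^-1))^-1)}].

Definition A_open : Prop :=
  forall U : set G, nbhs (1 : G) U ->
    (exists V : set H, nbhs (1 : H) V /\
       thin (f @^-1` (f @` U)) (f @^-1` V)) /\
    (forall g : G, exists V : set H, nbhs (1 : H) V /\
       lcommg g @` (f @^-1` V) `<=` f @^-1` (f @` U)).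

Definition Astar_open_along (s : H -> G) : Prop :=
  forall U : set G, nbhs (1 : G) U ->
    (exists V : set H, nbhs (1 : H) V /\ thin U (s @` V)) /\
    (forall g : G, exists V : set H, nbhs (1 : H) V /\
       lcommg g @` (s @` V) `<=` U).

Definition Astar_open : Prop :=
  exists s : H -> G, is_section s /\ Astar_open_along s.

Definition strongly_Astar_open : Prop :=
  exists s : H -> G,
    [/\ is_section s, quasihomomorphism s & Astar_open_along s].

Definition strongly_A_open : Prop :=
  forall U : set G, nbhs (1 : G) U ->
    (exists V : set H, nbhs (1 : H) V /\ thin U (f @^-1` V)) /\
    (forall g : G, exists V : set H, nbhs (1 : H) V /\
       lcommg g @` (f @^-1` V) `<=` U).

(* The identification of G with a topological normal subgroup of Gt is the
   embedding i: an injective homomorphism with normal range such that G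
   carries the topology induced from Gt along i. *)
Definition semitopological : Prop :=
  exists (Gt : topologicalGroupType) (i : UMagmaMorphism.type G Gt)
      (ft : UMagmaMorphism.type Gt H),
    [/\ injective i,
        forall x g : Gt, range i x -> range i (x ^ g)
      & @open G = @open (initial_topology i)] /\
    [/\ continuous ft,
        forall A : set Gt, open A -> open (ft @` A)
      & forall x : G, ft (i x) = f x].

End Openness.

(* Main.v *)
Require Import Defs.
From HB Require Import structures.
From mathcomp Require Import all_boot.
From mathcomp Require Import all_classical topology.

Set Implicit Arguments.
Unset Strict Implicit.

Local Open Scope classical_set_scope.
Local Open Scope group_scope.

(** Let N be the closure of 1 in G. An open set of G is a union of cosets of
    N, so when ker f is contained in N an open set cannot separate two points
    with the same image under f ([open_saturated]). This one fact makes the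
    four algebraic conditions interchangeable. An open U equals
    f @^-1` (f @` U), which removes the difference between A-open and strongly
    A-open. A conjugate or a commutator formed with x, and the one formed with
    s (f x), have the same image under f, so conditions on s @` V and on
    f @^-1` V agree for every section s. Finally the defect of a section from
    being a homomorphism has trivial image, hence lies in every neighbourhood
    of 1: every section is a quasihomomorphism.

    If f extends to an open ft on a group Gt in which G is normal, an x in G
    with small image has the same image as some small v in Gt, because ft is
    open. By normality the conjugate of u by v and the commutator of g and v
    belong to G; they are small by continuity of the operations of Gt, and
    saturation transfers this to x ([semitopological_strongly_A_open]).

    Conversely, let G' be the group G with the coarser topology pulled back
    from H along f. Strong A-openness says exactly what is needed for the
    conjugation action of G' on the topological group G to be jointly
    continuous ([strongly_A_open_conj]): thinness is continuity at (1, 1), and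
    the commutator condition moves it to the other points. So the semidirect
    product of G by G', with the product topology, is a topological group
    containing G as a topological normal subgroup, and
    (u, x) |-> f u * f x is an open continuous homomorphism on it which
    extends f. *)

(** * Limits of products and inverses *)

Section ContinuousOperations.
Context {T : Type} {G : topologicalGroupType} {F : set_system T}.
Context {FF : Filter F}.
Implicit Types (a b : T -> G) (x y : G).

Lemma cvgMg a b x y :
  a @ F --> x -> b @ F --> y -> (fun t => a t * b t) @ F --> x * y.
Proof.
move=> ax b_y.
exact: (cvg_comp2 ax b_y (mulg_continuous (x, y))).
Qed.

Lemma cvgVg a x : a @ F --> x -> (fun t => (a t)^-1) @ F --> x^-1.
Proof. by move=> ax; exact: (cvg_comp _ _ ax (@invg_continuous G x)). Qed.

End ContinuousOperations.

(** * Consequences of open sets being saturated *)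

(** Left conjugation is the form in which thinness meets the commutators
    [lcommg] and the action in the semidirect product. *)
Lemma thinE (G : topologicalGroupType) (U M : set G) :
  thin U M = nbhs (1 : G) [set u | forall x, M x -> U (x * u * x^-1)].
Proof.
rewrite /thin; congr nbhs; apply/seteqP; split => u /= uM x Mx.
  have [w Uw <-] := uM x Mx.
  by rewrite conjgE !mulgA mulgV mul1g mulgK.
exists (x * u * x^-1); first exact: uM.
by rewrite conjgE !mulgA mulVg mul1g mulgVK.
Qed.

Section Saturation.
Context {G H : topologicalGroupType} (f : UMagmaMorphism.type G H).
Hypothesis ker_f : [set g : G | f g = 1] `<=` closure [set (1 : G)].

(** Here n = x^-1 * y lies in the kernel, so every neighbourhood of n contains
    1. The set of z with y * z^-1 in W is such a neighbourhood, since
    y * n^-1 = x; at z = 1 it gives y in W. *)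
Lemma open_saturated (W : set G) x y : open W -> f x = f y -> W x -> W y.
Proof.
move=> oW fxy Wx.
set n := x^-1 * y.
have xE : x = y * n^-1 by rewrite invgM invgK mulgA mulgV mul1g.
have fn : closure [set (1 : G)] n.
  by apply: ker_f; rewrite /= gmulfM gmulfV fxy mulVg.
have cvgW : (fun z : G => y * z^-1) @ n --> x.
  by rewrite xE; apply: cvgMg; [exact: cvg_cst|apply: cvgVg; exact: cvg_id].
have /fn [_ [/= ->]] : nbhs n [set z : G | W (y * z^-1)].
  by apply: cvgW; exact: open_nbhs_nbhs.
by rewrite invg1 mulg1.
Qed.

(** A map into a single fiber of f is as good as constant for the topology,
    and this is how sections become quasihomomorphisms. *)
Lemma fiber_continuous (T : topologicalType) (F : T -> G) p :
  (forall q, f (F q) = f (F p)) -> {for p, continuous F}.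
Proof.
move=> fF A; rewrite nbhsE => -[B [oB Bp] BA].
apply: (@filterS _ (nbhs p) _ setT); last exact: filterT.
by move=> q _; exact/BA/(open_saturated oB (esym (fF q)) Bp).
Qed.

Lemma A_open_strongly_A_open : A_open f -> strongly_A_open f.
Proof.
move=> fU U; rewrite nbhsE => -[W [oW W1] WU].
have satW : f @^-1` (f @` W) `<=` U.
  by move=> y [x Wx fxy]; apply/WU/(open_saturated oW fxy).
have [[V [nV tV]] cV] := fU W (open_nbhs_nbhs (conj oW W1)); split.
  exists V; split=> //; rewrite !thinE in tV *.
  by apply: filterS tV => u uV x Vx; apply/satW/uV.
by move=> g; have [V' [nV' gV']] := cV g; exists V'; split=> // z /gV' /satW.
Qed.

Lemma strongly_A_open_along (s : H -> G) :
  is_section f s -> strongly_A_open f -> Astar_open_along s.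
Proof.
move=> [_ fs _] fU U nU.
have sV (V : set H) : s @` V `<=` f @^-1` V.
  by move=> _ [h Vh <-] /=; rewrite fs.
have [[V [nV tV]] cV] := fU U nU; split.
  exists V; split=> //; rewrite !thinE in tV *.
  by apply: filterS tV => u uV x /sV; exact: uV.
move=> g; have [W [nW gW]] := cV g; exists W; split=> //.
by apply: subset_trans gW; apply: image_subset; exact: sV.
Qed.

Lemma section_quasihomomorphism (s : H -> G) :
  is_section f s -> quasihomomorphism s.
Proof.
move=> [_ fs s1]; split=> // [|y]; apply: fiber_continuous => q;
  by rewrite !gmulfM !gmulfV /= !fs /= !(mulgV, mul1g, mulg1, invg1).
Qed.

(** Elements x and s (f x) differ by the kernel, so the conjugates and
    commutators that they define agree up to saturation. *)
Lemma Astar_open_A_open : Astar_open f -> A_open f.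
Proof.
move=> [s [[_ fs _] sU]] U; rewrite nbhsE => -[W [oW W1] WU].
have [[V [nV tV]] cV] := sU W (open_nbhs_nbhs (conj oW W1)).
have fW z : W z -> (f @^-1` (f @` U)) z by move=> Wz; exists z => //; exact: WU.
split.
  exists V; split=> //; rewrite !thinE in tV *.
  apply: filterS tV => u uV x Vx; apply: fW.
  have sV : (s @` V) (s (f x)) by exists (f x).
  apply: (open_saturated oW _ (uV _ sV)).
  by rewrite !gmulfM !gmulfV /= !fs.
move=> g; have [V' [nV' gV']] := cV g; exists V'; split=> // _ [x V'x <-].
apply: fW; have Wg : W (lcommg g (s (f x))).
  by apply: gV'; exists (s (f x)) => //; exists (f x).
by apply: (open_saturated oW _ Wg); rewrite /lcommg !gmulfM !gmulfV /= !fs.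
Qed.

(** An x with f x in the image of a small neighbourhood A of 1 in Gt satisfies
    f x = ft v for some v in A. Replacing x by v in a conjugate or a commutator
    gives an element that is still in G, by normality, has the same image, and
    is small by continuity of the operations of Gt. *)
Lemma semitopological_strongly_A_open :
  semitopological f -> strongly_A_open f.
Proof.
move=> [Gt [i [ft [[i_inj i_normal i_open] [ft_cont ft_open ft_i]]]]] U.
have open_pre (C : set Gt) : open C -> open (i @^-1` C).
  by move=> oC; rewrite i_open; exists C.
rewrite nbhsE => -[B [oB B1] BU].
have [C oC CB] : @open (initial_topology i) B by rewrite -i_open.
have C1 : C 1 by move: B1; rewrite -CB /= gmulf1.
have CU x : C (i x) -> U x by move=> Cx; apply: BU; rewrite -CB.
have nC : nbhs (1 : Gt) C by exact: open_nbhs_nbhs.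
(* Saturation in the form used below: z stands for the small element obtained
   from v, and x for the element of G obtained from the original point. *)
have lift z x : range i z -> ft z = f x -> C z -> U x.
  move=> [y _ <-{z}]; rewrite ft_i => fyx Cy.
  by apply/CU/(open_saturated (open_pre _ oC) fyx).
have nft (A : set Gt) : nbhs (1 : Gt) A -> nbhs (1 : H) (ft @` A).
  rewrite nbhsE => -[D [oD D1] DA].
  apply: filterS (image_subset _ DA) _; apply: open_nbhs_nbhs.
  by split; [exact: ft_open | exists 1 => //; rewrite gmulf1].
have i_conj v x : range i (v * i x * v^-1).
  have := i_normal (i x) v^-1; rewrite conjgE invgK mulgA; apply.
  by exists x.
split.
  have : (fun p : Gt * Gt => p.1 * p.2 * p.1^-1) @ (1, 1) --> (1 : Gt).
    rewrite -[X in _ --> X](mulgV 1) -[X in _ --> X / _](mulg1 1).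
    apply: cvgMg; first by apply: cvgMg; [exact: cvg_fst|exact: cvg_snd].
    by apply: cvgVg; exact: cvg_fst.
  move=> /(_ C nC) [[P Q] /= [nP nQ] PQC].
  exists (ft @` P); split; first exact: nft.
  rewrite thinE; move: nQ; rewrite nbhsE => -[D [oD D1] DQ].
  apply: (@filterS _ _ _ (i @^-1` D)).
    move=> u /= /DQ Qu x [v Pv ftv].
    apply: (lift (v * i u * v^-1)); first exact: i_conj.
      by rewrite !gmulfM !gmulfV /= ftv ft_i.
    exact: (PQC (v, i u)).
  by apply: open_nbhs_nbhs; split; [exact: open_pre|rewrite /= gmulf1].
move=> g.
have : (fun v : Gt => lcommg (i g) v) @ (1 : Gt) --> (1 : Gt).
  rewrite /lcommg -[X in _ --> X](mulgV (i g)) -[X in _ --> X](mulg1 _).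
  rewrite -[X in _ --> X * _ * _](mulg1 (i g)) -[X in _ --> _ * X]invg1.
  apply: cvgMg; last by apply: cvgVg; exact: cvg_id.
  apply: cvgMg; last exact: cvg_cst.
  by apply: cvgMg; [exact: cvg_cst|exact: cvg_id].
move=> /(_ C nC) nP; exists (ft @` [set v | C (lcommg (i g) v)]).
split; first exact: nft.
move=> _ [x [v Cv ftv] <-]; apply: lift Cv; last first.
  by rewrite /lcommg !gmulfM !gmulfV /= ftv ft_i.
have [y _ yE] := i_conj v g^-1.
exists (g * y) => //; rewrite gmulfM yE /lcommg gmulfV.
by rewrite !mulgA.
Qed.

End Saturation.

Lemma exists_section (G H : topologicalGroupType)
    (f : UMagmaMorphism.type G H) :
  (forall h : H, exists g : G, f g = h) -> exists s : H -> G, is_section f s.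
Proof.
move=> f_surj.
pose s h := if h == 1 then 1 else sval (cid (f_surj h)).
have fs h : f (s h) = h.
  rewrite /s; case: eqP => [->|_]; first exact: gmulf1.
  by case: (cid _).
by exists s; split=> //; [exact: can_inj fs|rewrite /s eqxx].
Qed.

(** * The semidirect product by conjugation *)

(** The two factors are the same group with different topologies: the first is
    normal and keeps the topology of G, the second acts by conjugation and
    carries the topology pulled back along f. *)
Definition semidirect {G H : topologicalGroupType}
  (f : UMagmaMorphism.type G H) : Type := (G * initial_topology f)%type.

Section Semidirect.
Context {G H : topologicalGroupType} (f : UMagmaMorphism.type G H).
Local Notation S := (semidirect f).

Let one : S := (1, (1 : G)).
Let inv (p : S) : S := ((p.2 : G)^-1 * p.1^-1 * (p.2 : G), (p.2 : G)^-1).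
Let mul (p q : S) : S :=
  (p.1 * ((p.2 : G) * q.1 * (p.2 : G)^-1), (p.2 : G) * (q.2 : G)).

Let mulA : associative mul.
Proof.
move=> [u x] [v y] [w z]; congr pair => /=; last exact: mulgA.
by rewrite invgM !mulgA mulgVK.
Qed.

Let mul1 : left_id one mul.
Proof. by move=> [u x]; rewrite /mul/= !mul1g invg1 mulg1. Qed.

Let mulr1 : right_id one mul.
Proof. by move=> [u x]; rewrite /mul/= !mulg1 mulgV mulg1. Qed.

Let mulVl : left_inverse one inv mul.
Proof.
move=> [u x]; congr pair => /=; last exact: mulVg.
by rewrite invgK !mulgA mulgK mulgVK mulVg.
Qed.

Let mulVr : right_inverse one inv mul.
Proof.
move=> [u x]; congr pair => /=; last exact: mulgV.
by rewrite !mulgA mulgK mulgK mulgV.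
Qed.

HB.instance Definition _ := Topological.on S.
HB.instance Definition _ := isGroup.Build S mulA mul1 mulr1 mulVl mulVr.

Definition semidirect_inl (u : G) : S := (u, (1 : G)).

Definition semidirect_lift (p : S) : H := f p.1 * f p.2.

Fact semidirect_inl_morphism : monoid_morphism semidirect_inl.
Proof.
split=> // u v; congr pair => /=; last by rewrite mulg1.
by rewrite invg1 mulg1 mul1g.
Qed.

HB.instance Definition _ :=
  isUMagmaMorphism.Build G S semidirect_inl semidirect_inl_morphism.

Fact semidirect_lift_morphism : monoid_morphism semidirect_lift.
Proof.
split=> [|[u x] [v y]]; first by rewrite /semidirect_lift !gmulf1 mulg1.
rewrite /semidirect_lift/= !gmulfM !gmulfV /= !mulgA.
by rewrite mulgVK.
Qed.

HB.instance Definition _ :=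
  isUMagmaMorphism.Build S H semidirect_lift semidirect_lift_morphism.

Lemma semidirect_normal (p q : S) :
  range semidirect_inl p -> range semidirect_inl (p ^ q).
Proof.
case: q => v y [u _ <-].
exists ((y : G)^-1 * v^-1 * u * v * y) => //; rewrite conjgE.
congr pair => /=.
  by rewrite invg1 mulg1 mul1g invgK !mulgA mulgK.
by rewrite mul1g mulVg.
Qed.

Lemma open_semidirect_inl :
  @open G = @open (initial_topology semidirect_inl).
Proof.
apply/seteqP; split => A.
  move=> oA; exists (fst @^-1` A) => //.
  by apply: open_comp => // p _; exact: cvg_fst.
move=> [B oB <-]; apply: open_comp => // u _.
by apply: (@cvg_pair _ _ _ _ (nbhs u) (nbhs (1 : initial_topology f)));
  [exact: cvg_id|exact: cvg_cst].
Qed.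

Lemma semidirect_lift_continuous :
  continuous f -> continuous semidirect_lift.
Proof.
move=> f_cont p.
have f1 : (fun q : S => f q.1) @ p --> f p.1.
  by apply: (cvg_comp fst f _ (f_cont p.1)); exact: cvg_fst.
have f2 : (fun q : S => f q.2) @ p --> f p.2.
  apply: (cvg_comp snd f _ (@initial_continuous _ _ f p.2)); exact: cvg_snd.
exact: cvgMg f1 f2.
Qed.

(** Already the fiber over a fixed u is mapped to an open set: a neighbourhood
    of x in the pulled back topology contains the preimage of an open V, and
    since f is onto, y |-> f u * f y maps that preimage onto the translate of V
    by f u. *)
Lemma semidirect_lift_open (f_surj : forall h, exists g, f g = h) (A : set S) :
  open A -> open (semidirect_lift @` A).
Proof.
rewrite !openE => oA _ [[u x] Aux <-].
have [[P Q] /= [nP [_ [[V oV <-] Vx VQ]]] PQA] := oA _ Aux.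
have cvgV : (fun h => (f u)^-1 * h) @ (f u * f x) --> f x.
  rewrite -[X in _ --> X](mulKg (f u)).
  by apply: cvgMg; [exact: cvg_cst|exact: cvg_id].
have : nbhs (f u * f x) [set h | V ((f u)^-1 * h)].
  by apply: cvgV; exact: open_nbhs_nbhs.
apply: filterS => h /= Vh; have [y fy] := f_surj ((f u)^-1 * h).
exists (u, y); last by rewrite /semidirect_lift/= fy mulVKg.
apply: PQA; split => /=; first exact: nbhs_singleton.
by apply: VQ; rewrite /= fy.
Qed.

End Semidirect.

(** * Continuity of conjugation *)

Section ConjugationContinuous.
Context {G H : topologicalGroupType} (f : UMagmaMorphism.type G H).
Hypothesis fA : strongly_A_open f.
Context {T : Type} {F : set_system T} {FF : Filter F}.
Implicit Types (a b : T -> G).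

Lemma strongly_A_open_conj1 a b :
  (f \o a) @ F --> (1 : H) -> b @ F --> (1 : G) ->
  (fun t => a t * b t * (a t)^-1) @ F --> (1 : G).
Proof.
move=> a1 b1 U nU; have [[V [nV]]] := fA nU; rewrite thinE => tV _.
by apply: (@filterS2 T F FF _ _ _ _ (a1 V nV) (b1 _ tV)) => t Vat; apply.
Qed.

Lemma strongly_A_open_lcommg a g :
  (f \o a) @ F --> (1 : H) -> (fun t => lcommg g (a t)) @ F --> (1 : G).
Proof.
move=> a1 U nU; have [_ /(_ g) [V [nV gV]]] := fA nU.
by apply: (@filterS T F FF _ _ _ (a1 V nV)) => t Vat; apply: gV; exists (a t).
Qed.

(** With g = x * u * x^-1, y = a * x^-1 and w = g^-1 * (x * b * x^-1), the
    conjugate of b by a is the conjugate of g * w by y, that is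
    g * [g^-1, y] * (y * w * y^-1). As f y and w tend to 1, the commutator
    condition controls the second factor and thinness the third. *)
Lemma strongly_A_open_conj a b x u :
  (f \o a) @ F --> f x -> b @ F --> u ->
  (fun t => a t * b t * (a t)^-1) @ F --> x * u * x^-1.
Proof.
move=> ax bu; pose g := x * u * x^-1.
pose y t := a t * x^-1; pose w t := g^-1 * (x * b t * x^-1).
have y1 : (f \o y) @ F --> (1 : H).
  rewrite (_ : f \o y = fun t => (f \o a) t * (f x)^-1).
    by rewrite -(mulgV (f x)); apply: cvgMg => //; exact: cvg_cst.
  by apply/funext => t; rewrite /y/= gmulfM gmulfV.
have w1 : w @ F --> (1 : G).
  rewrite -(mulVg g); apply: cvgMg; first exact: cvg_cst.
  apply: cvgMg; last exact: cvg_cst.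
  by apply: cvgMg => //; exact: cvg_cst.
rewrite (_ : (fun t => _) =
    fun t => g * lcommg g^-1 (y t) * (y t * w t * (y t)^-1)).
  rewrite -[X in _ --> X]mulg1; apply: cvgMg.
    rewrite -[X in _ --> X]mulg1; apply: cvgMg; first exact: cvg_cst.
    exact: strongly_A_open_lcommg.
  exact: strongly_A_open_conj1.
apply/funext => t; rewrite /lcommg /w /y invgK !invgM !invgK !mulgA.
by rewrite !(mulgV, mul1g, mulgVK, mulgK).
Qed.

End ConjugationContinuous.

(** * The semidirect product as a topological group *)

Section SemidirectTopologicalGroup.
Context {G H : topologicalGroupType} (f : UMagmaMorphism.type G H).
Hypothesis fA : strongly_A_open f.
Local Notation S := (semidirect f).

Lemma cvg_initial_topology (T : Type) (F : set_system T) {FF : Filter F}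
    (a : T -> initial_topology f) (x : initial_topology f) :
  (f \o a) @ F --> f x -> a @ F --> x.
Proof.
move=> fa U [_ /= [[W oW <-] Wx WU]].
apply: (@filterS T F FF _ _ (fun t => WU (a t))).
by apply: fa; exact: open_nbhs_nbhs.
Qed.

Lemma semidirect_mul_continuous : continuous (fun p : S * S => p.1 * p.2).
Proof.
move=> p.
have p11 : (fun q : S * S => q.1.1) @ p --> p.1.1.
  exact: (cvg_comp _ _ cvg_fst cvg_fst).
have p21 : (fun q : S * S => q.2.1) @ p --> p.2.1.
  exact: (cvg_comp _ _ cvg_snd cvg_fst).
have p12 : (fun q : S * S => f q.1.2) @ p --> f p.1.2.
  apply: (cvg_comp (fun q => q.1.2) f _ (@initial_continuous _ _ f p.1.2)).
  exact: (cvg_comp _ _ cvg_fst cvg_snd).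
have p22 : (fun q : S * S => f q.2.2) @ p --> f p.2.2.
  apply: (cvg_comp (fun q => q.2.2) f _ (@initial_continuous _ _ f p.2.2)).
  exact: (cvg_comp _ _ cvg_snd cvg_snd).
have conj2 : (fun q : S * S => (q.1.2 : G) * q.2.1 * (q.1.2 : G)^-1) @ p -->
    (p.1.2 : G) * p.2.1 * (p.1.2 : G)^-1.
  exact: (strongly_A_open_conj fA (a := fun q : S * S => q.1.2)).
have mul2 : (fun q : S * S => (q.1.2 : G) * (q.2.2 : G) : initial_topology f)
    @ p --> ((p.1.2 : G) * (p.2.2 : G) : initial_topology f).
  apply: cvg_initial_topology => /=; rewrite gmulfM.
  rewrite (_ : _ \o _ = fun q : S * S => f q.1.2 * f q.2.2); first exact: cvgMg.
  by apply/funext => q; rewrite /= gmulfM.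
apply: (@cvg_pair _ _ _ _ (nbhs (p.1 * p.2).1) (nbhs (p.1 * p.2).2)).
  exact: (cvgMg p11 conj2).
exact: mul2.
Qed.

Lemma semidirect_inv_continuous : continuous (fun p : S => p^-1).
Proof.
move=> p.
have p1 : (fun q : S => q.1) @ p --> p.1 by exact: cvg_fst.
have p2 : (fun q : S => f q.2) @ p --> f p.2.
  by apply: (cvg_comp snd f _ (@initial_continuous _ _ f p.2)); exact: cvg_snd.
have p2V : (f \o (fun q : S => (q.2 : G)^-1)) @ p --> f (p.2 : G)^-1.
  rewrite gmulfV (_ : f \o _ = fun q : S => (f q.2)^-1); first exact: cvgVg.
  by apply/funext => q; rewrite /= gmulfV.
have conj : (fun q : S => (q.2 : G)^-1 * q.1^-1 * (q.2 : G)^-1^-1) @ p -->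
    (p.2 : G)^-1 * p.1^-1 * (p.2 : G)^-1^-1.
  exact: (strongly_A_open_conj fA (a := fun q : S => (q.2 : G)^-1)
    p2V (cvgVg p1)).
have inv2 : (fun q : S => (q.2 : G)^-1 : initial_topology f)
    @ p --> ((p.2 : G)^-1 : initial_topology f).
  exact: cvg_initial_topology.
(* The first component of q^-1 is the conjugate of q.1^-1 by q.2^-1. *)
suff -> : (fun q : S => q^-1) = (fun q : S =>
    ((q.2 : G)^-1 * q.1^-1 * (q.2 : G)^-1^-1, (q.2 : G)^-1)).
  exact: (@cvg_pair _ _ _ _ (nbhs (_ : G)) (nbhs (_ : initial_topology f))
            _ _ _ _ _ conj inv2).
by apply/funext => q; rewrite invgK.
Qed.

End SemidirectTopologicalGroup.

Lemma strongly_A_open_semitopological (G H : topologicalGroupType)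
    (f : UMagmaMorphism.type G H) :
  continuous f -> (forall h : H, exists g : G, f g = h) ->
  strongly_A_open f -> semitopological f.
Proof.
move=> f_cont f_surj fA.
pose Gt : topologicalGroupType := HB.pack (semidirect f)
  (isTopologicalGroup.Build (semidirect f)
     (semidirect_mul_continuous fA) (semidirect_inv_continuous fA)).
exists Gt, (@semidirect_inl G H f), (@semidirect_lift G H f); split; split.
- by move=> u v [].
- exact: semidirect_normal.
- exact: open_semidirect_inl.
- exact: semidirect_lift_continuous.
- by move=> A; exact: semidirect_lift_open.
- by move=> x; rewrite /= /semidirect_lift/= gmulf1 mulg1.
Qed.

(** * The equivalences *)

Theorem theorem4p29 (G H : topologicalGroupType)
    (f : UMagmaMorphism.type G H)
    (f_continuous : continuous f)
    (f_surjective : forall h : H, exists g : G, f g = h)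
    (ker_f : [set g : G | f g = 1] `<=` closure [set (1 : G)]) :
  [<-> strongly_A_open f;
       strongly_Astar_open f;
       Astar_open f;
       A_open f;
       semitopological f].
Proof.
have [s fs] := exists_section f_surjective.
tfae.
- move=> fA; exists s; split; first exact: fs.
    exact: (section_quasihomomorphism ker_f fs).
  exact: (strongly_A_open_along fs).
- by move=> [t [ft _ tU]]; exists t.
- exact: Astar_open_A_open.
- move=> fA; apply: strongly_A_open_semitopological => //.
  exact: A_open_strongly_A_open.
- exact: semitopological_strongly_A_open.
Qed.
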